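(* Let $X$ be a reflexive and strictly convex Banach space, let $A_1,\dots,A_m$ be nonempty closed and convex subsets of $X$, and suppose that $(A_i-A_i)\cap(A_{i+1}-A_{i+1})=\{0\}$ for all $i\in\{1,\dots,m\}$. Let $1\le p\le\infty$, let $\alpha\in(0,1)$ satisfy $0<\alpha^m<\frac{1}{2^{1/p}}$, and let $T:\bigcup_{i=1}^m A_i\to\bigcup_{i=1}^m A_i$ be a cyclic $p$-$\alpha$-contraction. Then there exists a unique $x\in A_1$ such that $T^m x=x$ and $$d_p(x,Tx,T^2x,\dots,T^{m-1}x)=d_p(A_1,\dots,A_m).$$
   Context: Here $m$ is a positive integer, indices of the sets are cyclic ($A_{m+1}=A_1$), $d(x,y)=\|x-y\|$, $d(A,B)=\inf\{d(a,b):a\in A,b\in B\}$, $A-A=\{x-y:x,y\in A\}$, and $2^{1/p}=1$ for $p=\infty$. For $1\le p<\infty$, $d_p(A_1,\dots,A_m)=\left(\sum_{i=1}^m d(A_i,A_{i+1})^p\right)^{1/p}$, and $d_\infty(A_1,\dots,A_m)=\max_{1\le i\le m} d(A_i,A_{i+1})$. For points $x_1,\dots,x_m,y_1,\dots,y_m\in X$ with $y_{m+1}=y_1$, $d_p(x_1,\dots,x_m;y_1,\dots,y_m)=\left(\sum_{i=1}^m d(x_i,y_{i+1})^p\right)^{1/p}$ for $1\le p<\infty$, and $d_\infty(x_1,\dots,x_m;y_1,\dots,y_m)=\max_{1\le i\le m} d(x_i,y_{i+1})$. Also $d_p(x_1,\dots,x_m)=d_p(x_1,\dots,x_m;x_1,\dots,x_m)$.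 For $\alpha\in(0,1)$, a map $T:\bigcup_i A_i\to\bigcup_i A_i$ is a cyclic $p$-$\alpha$-contraction if $T(A_i)\subset A_{i+1}$ for $i=1,\dots,m$ and, for all $x_i,y_i\in A_i$ ($i=1,\dots,m$), $$d_p(Tx_1,\dots,Tx_m;Ty_1,\dots,Ty_m)\le d_p(x_1,\dots,x_m;y_1,\dots,y_m)-\alpha\, d_p(x_1,\dots,x_m;y_1,\dots,y_m)+\alpha\, d_p(A_1,\dots,A_m).$$ $X$ is strictly convex if for all $x,y,w\in X$ and $R>0$: $\|x-w\|\le R$, $\|y-w\|\le R$ and $x\ne y$ imply $\left\|\frac{x+y}{2}-w\right\|<R$. *)

(* Defs.v *)
From HB Require Import structures.
From mathcomp Require Import all_boot all_order all_algebra.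
From mathcomp Require Import all_classical all_reals all_analysis.

Set Implicit Arguments.
Unset Strict Implicit.
Unset Printing Implicit Defensive.

Import Order.TTheory GRing.Theory Num.Theory.
Import numFieldNormedType.Exports.

Local Open Scope classical_set_scope.
Local Open Scope ring_scope.


Section dual_space.
Context {R : realType} {X : normedModType R}.

Definition dual_pred : {pred X -> R^o} :=
  mem [set f : X -> R^o | linear f /\ continuous f].

Lemma dual_pred_submod_closed : submod_closed dual_pred.
Proof.
split=> [|a f g].
  rewrite inE; split=> [k u v|]; last exact: cst_continuous.
  by rewrite -[0]/(cst 0) /cst scaler0 addr0.
rewrite !inE => -[lf cf] [lg cg]; split=> [k u v|x].
  rewrite -[LHS]/(a *: f (k *: u + v) + g (k *: u + v)) lf lg.
  rewrite -[RHS]/(k *: (a *: f u + g u) + (a *: f v + g v)).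
  rewrite !scalerDr !scalerA [a * k]mulrC -!addrA; congr (_ + _).
  by rewrite addrCA.
by apply: (@continuousD _ R^o X (a \*: f) g); [apply: continuousZl_tmp; exact: cf|exact: cg].
Qed.

HB.instance Definition _ :=
  GRing.isSubmodClosed.Build R (X -> R^o) dual_pred dual_pred_submod_closed.

End dual_space.

Record dual {R : realType} (X : normedModType R) := Dual {
  dual_fun :> X -> R^o;
  dual_funP : dual_fun \in dual_pred
}.

Section dual_lmodType.
Context {R : realType} {X : normedModType R}.

HB.instance Definition _ := [isSub of dual X for @dual_fun R X].
HB.instance Definition _ := [Choice of dual X by <:].
HB.instance Definition _ := [SubChoice_isSubLmodule of dual X by <:].

Lemma dual_linear (f : dual X) : linear (f : X -> R^o).
Proof. by have := dual_funP f; rewrite inE => -[]. Qed.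

Lemma dual_continuous (f : dual X) : continuous (f : X -> R^o).
Proof. by have := dual_funP f; rewrite inE => -[]. Qed.

HB.instance Definition _ (f : dual X) :=
  GRing.isLinear.Build R X R^o *:%R (dual_fun f) (dual_linear f).

Lemma dual_bounded (f : dual X) :
  exists2 M, 0 < M & forall x, `|f x| <= M * `|x|.
Proof.
have /linear_boundedP : bounded_near f (nbhs (0 : X)).
  by apply: continuous_linear_bounded; exact: dual_continuous.
by move=> /pinfty_ex_gt0[M M0 fM]; exists M.
Qed.

Definition dual_norm (f : dual X) : R :=
  sup [set `|f x| | x in [set x : X | `|x| <= 1]].

Lemma dual_norm_has_sup (f : dual X) :
  has_sup [set `|f x| | x in [set x : X | `|x| <= 1]].
Proof.
split; first by exists `|f 0|, 0 => //=; rewrite normr0.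
have [M M0 fM] := dual_bounded f; exists M => _ [x /= x1 <-].
by rewrite (le_trans (fM x))// ger_pMr.
Qed.

Lemma dual_norm_ge0 (f : dual X) : 0 <= dual_norm f.
Proof.
rewrite (le_trans (normr_ge0 (f 0)))//.
apply: sup_upper_bound; first exact: dual_norm_has_sup.
by exists 0 => //=; rewrite normr0.
Qed.

Lemma dual_norm_le (f : dual X) (M : R) :
  (forall x, `|x| <= 1 -> `|f x| <= M) -> dual_norm f <= M.
Proof.
move=> fM; apply: ge_sup; first exact: (dual_norm_has_sup f).1.
by move=> _ [x /= x1 <-]; exact: fM.
Qed.

Lemma dual_normP (f : dual X) (x : X) : `|f x| <= dual_norm f * `|x|.
Proof.
have [->|x0] := eqVneq x 0; first by rewrite linear0 !normr0 mulr0.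
rewrite -ler_pdivrMr ?normr_gt0//.
apply: sup_upper_bound; first exact: dual_norm_has_sup.
exists (`|x|^-1 *: x) => /=.
  by rewrite normrZ normfV normr_id mulVf// normr_eq0.
by rewrite linearZ/= normrZ normfV normr_id mulrC.
Qed.

Lemma dual_normD (f g : dual X) :
  dual_norm (f + g) <= dual_norm f + dual_norm g.
Proof.
apply: dual_norm_le => x x1; rewrite (le_trans (ler_normD _ _))//.
by rewrite lerD// (le_trans (dual_normP _ x))// ler_piMr// dual_norm_ge0.
Qed.

Lemma dual_normZ (a : R) (f : dual X) : dual_norm (a *: f) = `|a| * dual_norm f.
Proof.
have leZ (b : R) (g : dual X) : dual_norm (b *: g) <= `|b| * dual_norm g.
  apply: dual_norm_le => x x1; rewrite [leLHS]normrM ler_wpM2l//.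
  by rewrite (le_trans (dual_normP _ x))// ler_piMr// dual_norm_ge0.
apply/eqP; rewrite eq_le leZ /=; have [->|a0] := eqVneq a 0.
  by rewrite normr0 mul0r dual_norm_ge0.
by rewrite -ler_pdivlMl ?normr_gt0// -normfV -{1}[f](scalerK a0) leZ.
Qed.

Lemma dual_norm_eq0 (f : dual X) : dual_norm f = 0 -> f = 0.
Proof.
move=> f0; apply/val_inj/funext => x; apply/eqP; rewrite -normr_le0.
by rewrite (le_trans (dual_normP f x))// f0 mul0r.
Qed.

HB.instance Definition _ := Lmodule_isNormed.Build R (dual X)
  dual_normD dual_normZ dual_norm_eq0.

End dual_lmodType.

Section bidual.
Context {R : realType} {X : normedModType R}.

Definition eval_at (x : X) : dual X -> R^o := fun f => f x.

Lemma eval_at_dual (x : X) : eval_at x \in @dual_pred R (dual X).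
Proof.
have lx : linear (eval_at x) by [].
pose ex : {linear dual X -> R^o} :=
  HB.pack (eval_at x) (GRing.isLinear.Build R (dual X) R^o *:%R _ lx).
rewrite inE; split=> //; apply: (@bounded_linear_continuous _ _ _ ex).
apply/bounded_funP => r; exists (r * `|x|) => f fr.
by rewrite (le_trans (dual_normP f x))// ler_wpM2r.
Qed.

Definition bidual_embedding (x : X) : dual (dual X) := Dual (eval_at_dual x).

End bidual.

Definition reflexive_space {R : realType} (X : normedModType R) : Prop :=
  forall phi : dual (dual X), exists x : X, bidual_embedding x = phi.

Definition strictly_convex_space {R : realType} (X : normedModType R) : Prop :=
  forall (x y w : X) (r : R), 0 < r ->
    `|x - w| <= r -> `|y - w| <= r -> x != y -> `|2^-1 *: (x + y) - w| < r.


Section cyclic.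
Context {R : realType} {X : normedModType R}.

Definition set_dist (A B : set X) : R :=
  inf [set `|a - b| | a in A & b in B].

Definition diff_set (A : set X) : set X := [set a - b | a in A & b in A].

(* Used only for 1 <= p <= +oo and u >= 0, so that the neutral element 0 of
   the maximum is harmless and the non-finite case is p = +oo. *)
Definition lp_norm (p : \bar R) (m : nat) (u : 'I_m -> R) : R :=
  if p is r%:E then (\sum_(i < m) u i `^ r) `^ r^-1
  else \big[Num.max/0]_(i < m) u i.

(* [ordS] is the successor of 'I_m in cyclic order, so that A_(m+1) = A_1. *)
Definition dp_sets (p : \bar R) (m : nat) (A : 'I_m -> set X) : R :=
  lp_norm p (fun i => set_dist (A i) (A (ordS i))).

Definition dp_points2 (p : \bar R) (m : nat) (x y : 'I_m -> X) : R :=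
  lp_norm p (fun i => `|x i - y (ordS i)|).

Definition dp_points (p : \bar R) (m : nat) (x : 'I_m -> X) : R :=
  dp_points2 p x x.

(* A self-map of the union of the A i is represented by a map on X, about which
   nothing is assumed outside that union. *)
Definition cyclic_contraction (p : \bar R) (alpha : R) (m : nat)
    (A : 'I_m -> set X) (T : X -> X) : Prop :=
  (forall i, T @` A i `<=` A (ordS i)) /\
  (forall x y : 'I_m -> X, (forall i, A i (x i)) -> (forall i, A i (y i)) ->
    dp_points2 p (T \o x) (T \o y) <=
      dp_points2 p x y - alpha * dp_points2 p x y + alpha * dp_sets p A).

End cyclic.

(* Main.v *)
(** Let [D = dp_sets p A] and let [S] shift a selection [x] of the sets [A i] by
    [(S x)_(i+1) = T x_i].  The contraction property reads
    [d_p(S x; S y) <= (1 - alpha) d_p(x; y) + alpha D], so the orbit [S^n x] is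
    minimizing for [z |-> d_p(z; z)], and comparing it with the fixed selection
    [S x] shows that it is bounded.  Reflexivity yields coordinatewise weak limits
    along an ultrafilter, Hahn-Banach separation keeps them in the sets [A i], and
    weak lower semicontinuity of the norm makes their selection [z] optimal, i.e.
    [d_p(z; z) = D].  Some index [j] satisfies [|z_j - z_(j+1)| = d(A_j, A_(j+1))]
    for every optimal selection [z]; strict convexity and the hypothesis on the
    difference sets make such a pair unique, so all optimal selections agree at
    [j].  As [S] preserves optimality, [S^m z] is a fixed point of [S], and fixed
    points of [S] are the cycles of [T], determined by their value at [j]. *)
Require Import Defs.
From HB Require Import structures.
From mathcomp Require Import all_boot all_order all_algebra.
From mathcomp Require Import all_classical all_reals all_analysis.
From mathcomp Require Import ring lra.

Set Implicit Arguments.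
Unset Strict Implicit.
Unset Printing Implicit Defensive.

Import Order.TTheory GRing.Theory Num.Theory.
Import numFieldNormedType.Exports.

Local Open Scope classical_set_scope.
Local Open Scope ring_scope.

(** * Sublinear functionals and the Hahn-Banach theorem *)

Definition sublinear {R : realType} {X : lmodType R} (p : X -> R) :=
  (forall x y, p (x + y) <= p x + p y) /\
  (forall (t : R) x, 0 <= t -> p (t *: x) = t * p x).

Section sublinear_functionals.
Context {R : realType} {X : lmodType R}.
Implicit Types (p q : X -> R) (x y : X) (K : set X).

Lemma sublinear0 p : sublinear p -> p 0 = 0.
Proof. by case=> _ pZ; rewrite -(scale0r (0 : X)) pZ// mul0r. Qed.

Lemma sublinear_geN p x : sublinear p -> - p (- x) <= p x.
Proof.
by move=> sp; have [+ _] := sp => /(_ x (- x)); rewrite subrr sublinear0//; lra.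
Qed.

Definition convex_like K := forall x y (t : R), 0 <= t <= 1 ->
  K x -> K y -> K (t *: x + (1 - t) *: y).

Lemma convex_setP (A : set X) : convex_set A -> convex_like A.
Proof.
move=> cA x y t t01 Ax Ay; pose i := Itv01 (andP t01).1 (andP t01).2.
by have := cA x y i (mem_set Ax) (mem_set Ay); rewrite inE.
Qed.

(** Merges two shifts along [K] into one, which is what the subadditivity of [sublinear_shift] rests
    on. *)
Lemma convex_cone_comb K x y (s t : R) : convex_like K -> K x -> K y ->
  0 <= s -> 0 <= t -> exists2 v, K v & (s + t) *: v = s *: x + t *: y.
Proof.
move=> cK Kx Ky s0 t0.
have [st0|st_neq0] := eqVneq (s + t) 0.
  have [-> ->] : s = 0 /\ t = 0 by lra.
  by exists x => //; rewrite addr0 !scale0r addr0.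
have st_gt0 : 0 < s + t by lra.
exists ((s / (s + t)) *: x + (1 - s / (s + t)) *: y).
  by apply: cK => //; rewrite divr_ge0//= ?ler_pdivrMr; lra.
rewrite scalerDr !scalerA mulrBr mulr1 mulrCA divff// mulr1.
by rewrite [s + t]addrC addrK.
Qed.

Definition shift_values p K (d : R) x : set R :=
  [set r | exists t v, [/\ 0 <= t, K v & r = p (x + t *: v) - t * d]].

(* The largest sublinear functional below [p] with values at most [- d] on [- K]. *)
Definition sublinear_shift p K d x : R := inf (shift_values p K d x).

Section shift.
Variables (p : X -> R) (K : set X) (d : R).
Hypotheses (sp : sublinear p) (cK : convex_like K) (K0 : K !=set0).
Hypothesis pK : forall v, K v -> d <= p v.

Let q := sublinear_shift p K d.

(** Writing [t *: v] as [(x + t *: v) + (- x)] gives [t * d <= p (t *: v) <= p (x + t *: v) + p (-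
    x)], so the infimum is finite. *)
Lemma shift_values_lb x : lbound (shift_values p K d x) (- p (- x)).
Proof.
move=> _ [t [v [t0 Kv ->]]]; have [pD pZ] := sp.
have := pD (x + t *: v) (- x); rewrite addrAC subrr add0r pZ//.
by have := ler_wpM2l t0 (pK Kv); lra.
Qed.

Lemma shift_values_has_inf x : has_inf (shift_values p K d x).
Proof.
have [v Kv] := K0; split; last by exists (- p (- x)); exact: shift_values_lb.
by exists (p (x + 0 *: v) - 0 * d), 0, v.
Qed.

Lemma sublinear_shift_le x t v : 0 <= t -> K v -> q x <= p (x + t *: v) - t * d.
Proof.
move=> t0 Kv; apply: inf_lbound; last by exists t, v.
exact: (shift_values_has_inf x).2.
Qed.

Lemma sublinear_shift_ge x r :
  (forall t v, 0 <= t -> K v -> r <= p (x + t *: v) - t * d) -> r <= q x.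
Proof.
move=> h; apply: lb_le_inf; first exact: (shift_values_has_inf x).1.
by move=> _ [t [v [t0 Kv ->]]]; exact: h.
Qed.

Lemma sublinear_shift_le_base x : q x <= p x.
Proof.
have [v Kv] := K0; have := sublinear_shift_le x (lexx 0) Kv.
by rewrite scale0r addr0 mul0r subr0.
Qed.

Lemma sublinear_shift_opp v : K v -> q (- v) <= - d.
Proof.
move=> Kv; have := sublinear_shift_le (- v) ler01 Kv.
by rewrite scale1r addNr sublinear0// mul1r sub0r.
Qed.

Lemma sublinear_shiftP : sublinear q.
Proof.
have [pD pZ] := sp.
(* The reverse inequality is this one applied to [t^-1] and [t *: x]. *)
have qZ_le t x : 0 < t -> q (t *: x) <= t * q x.
  move=> t0; rewrite -ler_pdivrMl//; apply: sublinear_shift_ge => s v s0 Kv.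
  rewrite ler_pdivrMl// mulrBr -pZ ?(ltW t0)// scalerDr scalerA mulrA.
  by apply: sublinear_shift_le => //; rewrite mulr_ge0// ltW.
split=> [x y|t x].
  rewrite -lerBlDr; apply: sublinear_shift_ge => s v s0 Kv.
  rewrite lerBlDr -lerBlDl; apply: sublinear_shift_ge => t w t0 Kw.
  have [u Ku stu] := convex_cone_comb cK Kv Kw s0 t0.
  have := sublinear_shift_le (x + y) (addr_ge0 s0 t0) Ku.
  rewrite stu addrACA; have := pD (x + s *: v) (y + t *: w); lra.
rewrite le_eqVlt => /predU1P[<-|t0].
  rewrite scale0r mul0r; apply/le_anti/andP; split.
    by rewrite -[leRHS](sublinear0 sp) sublinear_shift_le_base.
  apply: sublinear_shift_ge => s v s0 Kv; rewrite add0r pZ//.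
  by have := ler_wpM2l s0 (pK Kv); lra.
apply/le_anti/andP; split; first exact: qZ_le.
have := qZ_le t^-1 (t *: x); rewrite invr_gt0 scalerA mulVf ?gt_eqF// scale1r.
by move=> /(_ t0); rewrite ler_pdivlMl.
Qed.

End shift.

(** Zorn's lemma for the reversed pointwise order. A nonempty chain is bounded by its pointwise
    infimum, which is finite because a sublinear [s] below [q] satisfies [- q (- x) <= s x]. *)
Lemma sublinear_minimal q : sublinear q ->
  exists s, [/\ sublinear s, forall x, s x <= q x &
    forall s', sublinear s' -> (forall x, s' x <= s x) -> s' = s].
Proof.
move=> sq.
pose S := {s : X -> R | sublinear s /\ forall x, s x <= q x}.
pose rel (s t : S) := `[< forall x, sval t x <= sval s x >].
have [| | |C totC|[s [ss sq']] smin] := @Zorn S rel; last 1 first.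
- exists s; split=> // s' ss' s's.
  have sq'' : forall x, s' x <= q x by move=> x; exact: le_trans (sq' x).
  exact: (congr1 sval (smin (exist _ s' (conj ss' sq'')) (asboolT s's))).
- by move=> s; apply/asboolP.
- move=> s t u /asboolP st /asboolP tu; apply/asboolP => x.
  exact: le_trans (tu x) (st x).
- move=> [s Ps] [t Pt] /asboolP st /asboolP ts.
  apply: eq_exist; apply/funext => x.
  by apply/le_anti; rewrite (ts x) (st x).
- have [[s0 Cs0]|C0] := pselect (C !=set0); last first.
    exists (exist _ q (conj sq (fun x => lexx (q x)))) => s Cs.
    exfalso.
    by apply: C0; exists s.
  pose V x := [set sval s x | s in C].
  have V_inf x : has_inf (V x).
    split; first by exists (sval s0 x), s0.
    exists (- q (- x)) => _ [s Cs <-]; case: s {Cs} => s [ss sq'] /=.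
    by apply: le_trans (sublinear_geN x ss); rewrite lerN2.
  pose t x := inf (V x).
  have t_le s x : C s -> t x <= sval s x.
    by move=> Cs; apply: inf_lbound; [exact: (V_inf x).2|exists s].
  have t_ge x r : (forall s, C s -> r <= sval s x) -> r <= t x.
    move=> h; apply: lb_le_inf; first exact: (V_inf x).1.
    by move=> _ [s Cs <-]; exact: h.
  have tZ_le a x : 0 < a -> t (a *: x) <= a * t x.
    move=> a0; rewrite -ler_pdivrMl//; apply: (t_ge) => s Cs.
    rewrite ler_pdivrMl//; have [[_ sZ] _] := svalP s.
    by rewrite -sZ ?(ltW a0)// t_le.
  have st : sublinear t.
    split=> [x y|a x].
      rewrite -lerBlDr; apply: (t_ge) => s Cs; rewrite lerBlDr -lerBlDl.
      apply: (t_ge) => s' Cs'; rewrite lerBlDl.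
      (* The smaller of the two chain members, evaluated at [x + y], serves both infima at once. *)
      have [/asboolP ss's|/asboolP sss'] := totC _ _ Cs Cs'.
        have [[sD _] _] := svalP s'; apply: le_trans (t_le _ _ Cs') _.
        by apply: le_trans (sD _ _) _; rewrite lerD2r; exact: ss's.
      have [[sD _] _] := svalP s; apply: le_trans (t_le _ _ Cs) _.
      by apply: le_trans (sD _ _) _; rewrite lerD2l; exact: sss'.
    rewrite le_eqVlt => /predU1P[<-|a0].
      rewrite scale0r mul0r; have s00 s : C s -> sval s 0 = 0.
        by move=> _; exact: sublinear0 (svalP s).1.
      apply/le_anti/andP; split; first by rewrite -(s00 _ Cs0) t_le.
      by apply: (t_ge) => s /s00 ->.
    apply/le_anti/andP; split; first exact: tZ_le.
    have := tZ_le a^-1 (a *: x).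
    rewrite invr_gt0 scalerA mulVf ?gt_eqF// scale1r.
    by move=> /(_ a0); rewrite ler_pdivlMl.
  have tq x : t x <= q x by apply: le_trans (t_le _ _ Cs0) _; exact: (svalP s0).2.
  by exists (exist _ t (conj st tq)) => s Cs; apply/asboolP => x; exact: t_le.
Qed.

(* Shifting a minimal [f] along the single vector [a] cannot decrease it, which
   forces [f (- a) = - f a]. *)
Lemma hahn_banach q : sublinear q ->
  exists f : X -> R^o, linear f /\ forall x, f x <= q x.
Proof.
move=> /sublinear_minimal[f [sf fq fmin]]; exists f; split=> //.
have [fD fZ] := sf.
have fN a : f (- a) = - f a.
  pose K : set X := [set a].
  have cK : convex_like K.
    by move=> _ _ t _ -> ->; rewrite /K/= -scalerDl addrC subrK scale1r.
  have K0 : K !=set0 by exists a.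
  have fK v : K v -> f a <= f v by move=> ->.
  have := sublinear_shift_opp sf K0 fK (erefl : K a).
  rewrite (fmin _ (sublinear_shiftP sf cK K0 fK)
    (sublinear_shift_le_base sf K0 fK)).
  by have := sublinear_geN (- a) sf; rewrite opprK; lra.
have fA x y : f (x + y) = f x + f y.
  apply/le_anti/andP; split; first exact: fD.
  by have := fD (- x) (- y); rewrite -opprD !fN; lra.
move=> a x y; rewrite fA; congr (_ + _).
have [a0|a0] := leP 0 a; first by rewrite fZ.
rewrite -[a]opprK [in LHS]scaleNr fN fZ; last by lra.
by rewrite -[RHS]/(- - a * f x); lra.
Qed.

End sublinear_functionals.

(** If [B] lies in a finer filter but its preimage is not in [U], the complement of the preimage is
    in [U]; then [B] and its complement both lie in the finer filter. *)
Lemma ultra_fmap {I J : Type} (f : I -> J) (U : set_system I) :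
  UltraFilter U -> UltraFilter (f @ U).
Proof.
move=> FU; split=> [|G FG fUG]; first exact: fmap_proper_filter.
apply/seteqP; split=> // B GB; rewrite /fmap/=.
have [//|/(fUG (~` B)) GCB] := in_ultra_setVsetC (f @^-1` B) FU.
by exfalso; apply: (@filter_not_empty _ G); rewrite -(setICr B); exact: filterI.
Qed.

(** * Separation by functionals and weak limits along an ultrafilter *)

Section weak_limits.
Context {R : realType} {X : normedModType R}.

Lemma norm_sublinear : sublinear (fun x : X => `|x|).
Proof.
split=> [x y|t x t0]; first exact: ler_normD.
by rewrite normrZ ger0_norm.
Qed.

Lemma linear_norm_le_dual (f : X -> R^o) :
  linear f -> (forall x, `|f x| <= `|x|) -> f \in @dual_pred R X.
Proof.
move=> lf f_le.
pose g : {linear X -> R^o} := HB.pack f (GRing.isLinear.Build R X R^o *:%R _ lf).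
rewrite inE; split=> //; apply: (@bounded_linear_continuous _ _ _ g).
by apply/bounded_funP => r; exists r => x; exact: le_trans (f_le x).
Qed.

(** Hahn-Banach for the norm shifted by [d] along [z - C]: domination by the norm bounds [f], and
    the bound [- d] at [c - z] separates. With [C] reduced to 0 and [d] the norm of [z], this yields
    a norming functional. *)
Lemma dual_separation (C : set X) (z : X) (d : R) :
  convex_like C -> C !=set0 -> (forall c, C c -> d <= `|z - c|) ->
  exists f : dual X,
    (forall x, `|f x| <= `|x|) /\ forall c, C c -> f c <= f z - d.
Proof.
move=> cC [c0 Cc0] zC; pose K := [set z - c | c in C].
have cK : convex_like K.
  move=> _ _ t t01 [c Cc <-] [c' Cc' <-].
  exists (t *: c + (1 - t) *: c'); first exact: cC.
  by rewrite !scalerBr addrACA -scalerDl [t + _]addrC subrK scale1r opprD.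
have K0 : K !=set0 by exists (z - c0), c0.
have Kd v : K v -> d <= `|v| by move=> [c Cc <-]; exact: zC.
have [f [lf fq]] := hahn_banach (sublinear_shiftP norm_sublinear cK K0 Kd).
have f_norm x : f x <= `|x|.
  exact: le_trans (fq x) (sublinear_shift_le_base norm_sublinear K0 Kd x).
have f0 : f 0 = 0 by have := lf 1 0 0; rewrite !scale1r addr0; lra.
have fN x : f (- x) = - f x by have := lf (-1) x 0; rewrite f0 !addr0 !scaleN1r.
have f_le x : `|f x| <= `|x|.
  by rewrite ler_norml f_norm andbT lerNl -fN -[leRHS]normrN f_norm.
exists (Dual (linear_norm_le_dual lf f_le)); split=> //= c Cc.
have /(le_trans (fq _)) :
    sublinear_shift (fun x : X => `|x|) K d (- (z - c)) <= - d.
  by apply: (sublinear_shift_opp norm_sublinear K0 Kd); exists c.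
rewrite opprB; have := lf 1 c (- z); rewrite !scale1r => ->; rewrite fN.
by rewrite lerBlDl.
Qed.

Definition weak_limit {I : Type} (U : set_system I) (u : I -> X) (z : X) :=
  forall f : dual X, f (u i) @[i --> U] --> f z.

Context {I : Type} {U : set_system I} {FU : UltraFilter U}.

(** For each [f], the values [f (u i)] stay in a compact segment and so converge along [U]. The
    limits form a bounded linear functional of [f], which reflexivity represents by a point. *)
Lemma weak_limit_exists (u : I -> X) (M : R) : reflexive_space X ->
  (forall i, `|u i| <= M) -> exists z, weak_limit U u z.
Proof.
move=> reflX uM.
have ex_lim (f : dual X) : exists r : R^o, `|r| <= dual_norm f * M /\
    f (u i) @[i --> U] --> r.
  have := @segment_compact R (- (dual_norm f * M)) (dual_norm f * M).
  rewrite compact_ultra => /(_ ((f \o u) @ U)) [].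
  - exact: ultra_fmap.
  - apply: (@filterE _ U) => i /=; rewrite in_itv/= -ler_norml.
    by rewrite (le_trans (dual_normP f (u i)))// ler_wpM2l ?dual_norm_ge0.
  - move=> r [/= rM rl]; exists r; split=> //.
    by rewrite ler_norml; rewrite in_itv/= in rM.
have [phi phiP] := choice ex_lim.
have lphi : linear phi.
  move=> a f g; have cvl := (phiP (a *: f + g)).2.
  have cvr : (a *: f + g) (u i) @[i --> U] --> a *: phi f + phi g.
    apply: (@cvgD _ R^o); last exact: (phiP g).2.
    by apply: (@cvgZl_tmp _ R^o); exact: (phiP f).2.
  exact: (@cvg_unique _ _ _ _ _ _ cvl cvr).
have phi_dual : phi \in @dual_pred R (dual X).
  pose g : {linear dual X -> R^o} :=
    HB.pack phi (GRing.isLinear.Build R (dual X) R^o *:%R _ lphi).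
  rewrite inE; split=> //; apply: (@bounded_linear_continuous _ _ _ g).
  have M0 : 0 <= M.
    have [i _] := @filter_ex _ U _ setT filterT.
    exact: le_trans (normr_ge0 _) (uM i).
  apply/bounded_funP => r; exists (r * M) => f fr.
  by rewrite (le_trans (phiP f).1)// ler_wpM2r.
have [z zphi] := reflX (Dual phi_dual); exists z => f.
have -> : f z = phi f by rewrite -[RHS]/(dual_fun (Dual phi_dual) f) -zphi.
exact: (phiP f).2.
Qed.

(** A point outside [A] has positive distance [d] to it, and a separating functional would keep
    [f (u i)] at least [d] below its limit [f z]. *)
Lemma weak_limit_closed_convex (A : set X) (u : I -> X) (z : X) :
  closed A -> convex_like A -> (forall i, A (u i)) -> weak_limit U u z -> A z.
Proof.
move=> clA cA uA uz; apply: contrapT => nAz.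
have [d /= d0 dA] : exists2 d : R, 0 < d & forall c, A c -> d <= `|z - c|.
  have /nbhs_ballP[d /= d0 dA] : nbhs z (~` A).
    by apply: open_nbhs_nbhs; split=> //; exact: closed_openC.
  exists d => // c Ac; rewrite leNgt; apply/negP => zc.
  by apply: (dA c); rewrite // -ball_normE.
have [i0 _] := @filter_ex _ U _ setT filterT.
have [f [_ fz]] := dual_separation cA (ex_intro _ _ (uA i0)) dA.
have : f z <= f z - d.
  apply: (@closed_cvg _ R^o U _ _ (fun r : R => r <= f z - d) _ _ _ (uz f)).
    exact: closed_le.
  by apply: nearW => i; exact: fz.
by lra.
Qed.

(** Weak lower semicontinuity of the norm, in a form usable at a single index [i]. *)
Lemma weak_limit_dist_le (u v : I -> X) (y z : X) (e : R) :
  weak_limit U u y -> weak_limit U v z -> 0 < e ->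
  \forall i \near U, `|y - z| <= `|u i - v i| + e.
Proof.
move=> uy vz e0.
have c0 : convex_like [set (0 : X)].
  by move=> _ _ t _ -> ->; rewrite /= !scaler0 addr0.
(* Separating [y - z] from 0 gives a functional norming [y - z]. *)
have [|f [f_le f0]] :=
    @dual_separation [set 0] (y - z) `|y - z| c0 (ex_intro _ 0 erefl).
  by move=> _ ->; rewrite subr0.
have fyz : `|y - z| - e < f y - f z.
  by have := f0 _ erefl; rewrite linear0 linearB /=; lra.
have cv : (f (u i) - f (v i)) @[i --> U] --> f y - f z.
  by apply: (@cvgB _ R^o); [exact: uy|exact: vz].
apply: filterS (@cvgr_gt R I U _ _ _ cv _ fyz) => i /ltW.
rewrite -linearB lerBlDr => /le_trans; apply.
by rewrite lerD2r (le_trans (ler_norm _))// f_le.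
Qed.

End weak_limits.

(** * Norms of finite families and Minkowski's inequality *)

Section lp_norm_theory.
Context {R : realType} (m : nat).
Implicit Types (p : \bar R) (u v : 'I_m -> R) (r : R).

Lemma lp_norm_powR r u : 1 <= r -> lp_norm r%:E u `^ r = \sum_(i < m) u i `^ r.
Proof.
move=> r1; rewrite -powRrM mulVf ?powRr1//; last by rewrite gt_eqF//; lra.
by apply: sumr_ge0 => i _; exact: powR_ge0.
Qed.

Lemma powRK r (a : R) : 1 <= r -> 0 <= a -> (a `^ r) `^ r^-1 = a.
Proof. by move=> r1 a0; rewrite -powRrM mulfV ?powRr1// gt_eqF//; lra. Qed.

Lemma powR_convex r (a b t : R) : 1 <= r -> 0 <= a -> 0 <= b -> 0 <= t <= 1 ->
  (t * a + (1 - t) * b) `^ r <= t * a `^ r + (1 - t) * b `^ r.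
Proof.
move=> r1 a0 b0 /andP[t0 t1]; have := convex_powR r1 (Itv01 t0 t1).
move=> /(_ a b); rewrite !inE/= !in_itv/= a0 b0 => /(_ isT isT).
by rewrite !convRE.
Qed.

(** Convexity of the power at [(x + y) / (a + b)], the average of [x / a] and [y / b] with weights
    [a / (a + b)] and [b / (a + b)]. *)
Lemma powR_add_le r (x y a b : R) : 1 <= r ->
  0 <= x -> 0 <= y -> 0 < a -> 0 < b ->
  (x + y) `^ r <= (a + b) `^ r *
    (a / (a + b) * (x / a) `^ r + (1 - a / (a + b)) * (y / b) `^ r).
Proof.
move=> r1 x0 y0 a0 b0; set t := a / (a + b).
have t01 : 0 <= t <= 1 by rewrite /t divr_ge0/= ?ler_pdivrMr; lra.
have -> : x + y = (a + b) * (t * (x / a) + (1 - t) * (y / b)).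
  by rewrite /t; field; rewrite !gt_eqF// addr_gt0.
have xa : 0 <= x / a by rewrite divr_ge0// ltW.
have yb : 0 <= y / b by rewrite divr_ge0// ltW.
rewrite powRM; first by rewrite ler_wpM2l ?powR_ge0// powR_convex.
  by rewrite addr_ge0// ltW.
by rewrite addr_ge0// mulr_ge0//; lra.
Qed.

Lemma lp_norm_ge0 p u : (1 <= p)%E -> 0 <= lp_norm p u.
Proof.
case: p => [r||]//= _; first exact: powR_ge0.
exact: bigmax_ge_id.
Qed.

Lemma lp_norm_coord p u i : (1 <= p)%E -> (forall j, 0 <= u j) ->
  u i <= lp_norm p u.
Proof.
case: p => [r||]//=; last by move=> _ _; exact: le_bigmax.
rewrite lee_fin => r1 u0; rewrite -[leLHS](powRK r1)//.
apply: ge0_ler_powR; rewrite ?nnegrE ?invr_ge0 ?powR_ge0 ?sumr_ge0//; first by lra.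
  by move=> ? _; exact: powR_ge0.
by rewrite (bigD1 i)//= lerDl sumr_ge0// => ? _; exact: powR_ge0.
Qed.

Lemma lp_norm_le p u v : (1 <= p)%E -> (forall i, 0 <= u i) ->
  (forall i, u i <= v i) -> lp_norm p u <= lp_norm p v.
Proof.
case: p => [r| |] /=; last 2 first.
- move=> _ _ uv; apply: bigmax_le => [|i _]; first exact: bigmax_ge_id.
  by apply: le_trans (uv i) _; exact: (le_bigmax 0 v i).
- by [].
rewrite lee_fin => r1 u0 uv; apply: ge0_ler_powR.
- by rewrite invr_ge0 (le_trans ler01 r1).
- by rewrite nnegrE sumr_ge0// => ? _; exact: powR_ge0.
- by rewrite nnegrE sumr_ge0// => ? _; exact: powR_ge0.
apply: ler_sum => i _; apply: ge0_ler_powR; rewrite ?nnegrE//; first by lra.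
exact: le_trans (u0 i) (uv i).
Qed.

Lemma lp_normZ p (a : R) u : (1 <= p)%E -> 0 <= a -> (forall i, 0 <= u i) ->
  lp_norm p (fun i => a * u i) = a * lp_norm p u.
Proof.
case: p => [r||]//=; last first.
  move=> _ a0 u0; elim/big_ind2 : _ => [|x1 x2 y1 y2 -> ->|//].
    by rewrite mulr0.
  by rewrite maxr_pMr.
rewrite lee_fin => r1 a0 u0.
under eq_bigr => i _ do rewrite powRM//.
rewrite -mulr_sumr powRM ?powR_ge0 ?powRK// sumr_ge0// => i _.
exact: powR_ge0.
Qed.

(** For finite [p], take [a] and [b] in [powR_add_le] to be the norms of [u] and [v], and sum over
    the coordinates. *)
Lemma lp_normD p u v : (1 <= p)%E ->
  (forall i, 0 <= u i) -> (forall i, 0 <= v i) ->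
  lp_norm p (fun i => u i + v i) <= lp_norm p u + lp_norm p v.
Proof.
move=> p1 u0 v0.
(* A zero norm cannot be divided by, but then every coordinate vanishes. *)
have [Nu0|Nu_neq0] := eqVneq (lp_norm p u) 0.
  rewrite Nu0 add0r; apply: lp_norm_le => // i; first exact: addr_ge0.
  by rewrite gerDr -Nu0 lp_norm_coord.
have [Nv0|Nv_neq0] := eqVneq (lp_norm p v) 0.
  rewrite Nv0 addr0; apply: lp_norm_le => // i; first exact: addr_ge0.
  by rewrite gerDl -Nv0 lp_norm_coord.
case: p p1 Nu_neq0 Nv_neq0 => [r||]//; last first.
  move=> p1 _ _ /=; apply: bigmax_le => [|i _].
    by apply: addr_ge0; exact: bigmax_ge_id.
  by apply: lerD; [exact: (le_bigmax 0 u i)|exact: (le_bigmax 0 v i)].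
move aE : (lp_norm r%:E u) => a; move bE : (lp_norm r%:E v) => b p1 a_neq0 b_neq0.
have a_gt0 : 0 < a by rewrite lt_def a_neq0 -aE lp_norm_ge0.
have b_gt0 : 0 < b by rewrite lt_def b_neq0 -bE lp_norm_ge0.
have r1 : 1 <= r by rewrite -lee_fin.
rewrite -[leRHS](powRK r1) ?addr_ge0 ?(ltW a_gt0) ?(ltW b_gt0)//=.
apply: ge0_ler_powR.
- by rewrite invr_ge0 (le_trans ler01 r1).
- by rewrite nnegrE sumr_ge0// => ? _; exact: powR_ge0.
- by rewrite nnegrE powR_ge0.
have sum1 (w : 'I_m -> R) (c : R) : (forall i, 0 <= w i) -> 0 < c ->
    lp_norm r%:E w = c -> \sum_(i < m) (w i / c) `^ r = 1.
  move=> w0 c0 cE; under eq_bigr => i _ do rewrite powRM// ?invr_ge0 ?ltW//.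
  rewrite -mulr_suml -lp_norm_powR// cE -powRM ?invr_ge0 ?ltW//.
  by rewrite mulfV ?gt_eqF// powR1.
apply: le_trans.
  by apply: ler_sum => i _; exact: powR_add_le r1 (u0 i) (v0 i) a_gt0 b_gt0.
rewrite -mulr_sumr big_split/= -!mulr_sumr !sum1// !mulr1 addrC subrK.
by rewrite mulr1.
Qed.

Lemma lp_norm_ordS p u : lp_norm p (fun i => u (ordS i)) = lp_norm p u.
Proof.
have bS : bijective (@ordS m).
  by exists (@ord_pred m); [exact: ordSK|exact: ord_predK].
case: p => [r||]/=; last 2 first.
- by rewrite [RHS](reindex _ (onW_bij _ bS)).
- by rewrite [RHS](reindex _ (onW_bij _ bS)).
by rewrite [in RHS](reindex _ (onW_bij _ bS)).
Qed.

(* For finite [p] every index works; for [p = +oo] take one where [u] is maximal. *)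
Lemma lp_norm_tight p u : (1 <= p)%E -> (0 < m)%N -> (forall i, 0 <= u i) ->
  exists j, forall v, (forall i, u i <= v i) ->
    lp_norm p v <= lp_norm p u -> v j <= u j.
Proof.
move=> p1 m0 u0; pose i0 := Ordinal m0.
have [j _ ju] := @Order.TotalTheory.arg_maxP _ _ _ i0 xpredT u isT.
exists j => v uv vu; have v0 i : 0 <= v i := le_trans (u0 i) (uv i).
case: p p1 vu => [r| |] p1 vu; last 2 first.
- apply: le_trans (le_trans vu _); first exact: (le_bigmax 0 v j).
  by apply: bigmax_le => // i _; exact: ju.
- by [].
have r1 : 1 <= r by rewrite -lee_fin.
have r0 : 0 <= r := le_trans ler01 r1.
have sum_vu : \sum_(i < m) v i `^ r <= \sum_(i < m) u i `^ r.
  rewrite -(lp_norm_powR v r1) -(lp_norm_powR u r1).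
  by apply: ge0_ler_powR; rewrite ?nnegrE ?lp_norm_ge0.
have uv_pow i : u i `^ r <= v i `^ r.
  by apply: ge0_ler_powR; rewrite ?nnegrE.
(* The terms of [u] are at most those of [v] while the sums compare the other way, so all terms are
   equal. *)
have vu_pow : v j `^ r <= u j `^ r.
  move: sum_vu; rewrite (bigD1 j)//= [leRHS](bigD1 j)//=.
  have : \sum_(i < m | i != j) u i `^ r <= \sum_(i < m | i != j) v i `^ r.
    by apply: ler_sum => i _; exact: uv_pow.
  by move=> uv_rest vu_sum; rewrite -(lerD2r (\sum_(i < m | i != j) v i `^ r));
    apply: le_trans vu_sum _; rewrite lerD2l.
rewrite -[leLHS](powRK r1 (v0 j)) -[leRHS](powRK r1 (u0 j)).
by apply: ge0_ler_powR; rewrite ?nnegrE ?powR_ge0 ?invr_ge0.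
Qed.

End lp_norm_theory.

(** * Proximal pairs and optimal selections *)

Section cyclic_sets.
Context {R : realType} {X : normedModType R}.
Variables (m : nat) (A : 'I_m -> set X) (p : \bar R).
Implicit Types x y z : 'I_m -> X.
Hypotheses (A_neq0 : forall i, A i !=set0) (p_ge1 : (1 <= p)%E).

Definition selection x := forall i, A i (x i).

Lemma set_dist_le (B C : set X) b c : B b -> C c -> set_dist B C <= `|b - c|.
Proof.
move=> Bb Cc; apply: inf_lbound; last by exists b => //; exists c.
by exists 0 => _ [x _ [y _ <-]].
Qed.

Lemma set_dist_ge0 i j : 0 <= set_dist (A i) (A j).
Proof.
have [a Aa] := A_neq0 i; have [b Ab] := A_neq0 j.
apply: lb_le_inf; first by exists `|a - b|, a => //; exists b.
by move=> _ [x _ [y _ <-]].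
Qed.

Lemma dp_points2_ge x y : selection x -> selection y ->
  dp_sets p A <= dp_points2 p x y.
Proof.
move=> Ax Ay; apply: lp_norm_le => // i; first exact: set_dist_ge0.
exact: set_dist_le.
Qed.

(** The triangle inequality through [y (ordS i)] produces the correction term at shifted indices;
    rotation invariance of [lp_norm] undoes the shift. *)
Lemma dp_points2_triangle x y z :
  dp_points2 p x z <= dp_points2 p x y + lp_norm p (fun i => `|y i - z i|).
Proof.
rewrite -[X in _ + X]lp_norm_ordS.
apply: le_trans; last exact: lp_normD.
apply: lp_norm_le => // i; rewrite -[x i - _](subrKA (y (ordS i))).
exact: ler_normD.
Qed.

Section optimal_selections.
Hypotheses (m_gt0 : (0 < m)%N) (scX : strictly_convex_space X).
Hypothesis A_convex : forall i, convex_set (A i).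
Hypothesis A_diff : forall i,
  diff_set (A i) `&` diff_set (A (ordS i)) = [set 0].

(** If the two differences were distinct, strict convexity would make their midpoint shorter than
    [d], yet it is a difference of points of the two convex sets. Hence [a - a' = b - b'] lies in
    both difference sets and is 0. *)
Lemma proximal_pair_unique i a b a' b' :
  A i a -> A (ordS i) b -> A i a' -> A (ordS i) b' ->
  `|a - b| <= set_dist (A i) (A (ordS i)) ->
  `|a' - b'| <= set_dist (A i) (A (ordS i)) -> a = a'.
Proof.
set d := set_dist _ _ => Aa Ab Aa' Ab' ab a'b'.
have d0 : 0 <= d := set_dist_ge0 i (ordS i).
suff abE : a - b = a' - b'.
  have : (diff_set (A i) `&` diff_set (A (ordS i))) (a - a').
    split; first by exists a => //; exists a'.
    exists b => //; exists b' => //.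
    have -> : a = a' - b' + b by rewrite -abE subrK.
    by rewrite addrAC [a' - b' - a']addrAC subrr add0r addrC.
  by rewrite A_diff => /eqP; rewrite subr_eq0 => /eqP.
apply/eqP/negPn/negP => ab_neq.
(* Strict convexity asks for a positive radius; for [d = 0] both differences are 0. *)
have d_gt0 : 0 < d.
  rewrite lt_def d0 andbT; apply/eqP => d_eq0; move: ab_neq ab a'b'.
  by rewrite d_eq0 !normr_le0 => /eqP + /eqP ab0 /eqP a'b'0; rewrite ab0 a'b'0.
have half_convex k u v : A k u -> A k v -> A k (2^-1 *: u + (1 - 2^-1) *: v).
  by apply: convex_setP => //; lra.
have := scX (w := 0) d_gt0; rewrite /= => /(_ (a - b) (a' - b')).
rewrite !subr0 => /(_ ab a'b' ab_neq); apply/negP; rewrite -leNgt.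
have := set_dist_le (half_convex _ _ _ Aa Aa') (half_convex _ _ _ Ab Ab').
have -> : (1 - 2^-1 : R) = 2^-1 by lra.
by rewrite -!scalerDr -scalerBr opprD addrACA.
Qed.

(** The index comes from [lp_norm_tight] for the distances between neighbouring sets, so it is the
    same for all optimal selections. *)
Lemma optimal_selections_agree : exists j : 'I_m, forall x y,
  selection x -> dp_points p x <= dp_sets p A ->
  selection y -> dp_points p y <= dp_sets p A -> x j = y j.
Proof.
have [j jP] := lp_norm_tight p_ge1 m_gt0 (fun i => set_dist_ge0 i (ordS i)).
have tight x : selection x -> dp_points p x <= dp_sets p A ->
    `|x j - x (ordS j)| <= set_dist (A j) (A (ordS j)).
  move=> Ax /(jP (fun i => `|x i - x (ordS i)|)); apply => i.
  exact: set_dist_le.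
exists j => x y Ax xD Ay yD.
by apply: proximal_pair_unique (tight _ Ax xD) (tight _ Ay yD).
Qed.

End optimal_selections.

(** * Orbits of the shift and existence of an optimal selection *)

Section contraction.
Variables (alpha : R) (T : X -> X).
Hypotheses (alpha_gt0 : 0 < alpha) (alpha_lt1 : alpha < 1).
Hypothesis T_contr : cyclic_contraction p alpha A T.

Definition cyclic_step x : 'I_m -> X := fun i => T (x (ord_pred i)).
Let S := cyclic_step.
Let D := dp_sets p A.

Lemma cyclic_stepE x i : S x (ordS i) = T (x i).
Proof. by rewrite /S /cyclic_step ordSK. Qed.

(** Each step applies [T] once and moves the value to the next index. *)
Lemma iter_cyclic_stepE n k x i :
  iter (k + n) S x (iter k (@ordS m) i) = iter k T (iter n S x i).
Proof. by elim: k => //= k IHk; rewrite cyclic_stepE IHk. Qed.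

Lemma cyclic_step_selection x : selection x -> selection (S x).
Proof.
move=> Ax i; rewrite -(ord_predK i) cyclic_stepE.
by apply: T_contr.1; exists (x (ord_pred i)).
Qed.

Lemma iter_step_selection n x : selection x -> selection (iter n S x).
Proof. by move=> Ax; elim: n => //= n IHn; exact: cyclic_step_selection. Qed.

(** Up to a rotation of the indices, the left side is the one in the definition of a cyclic
    contraction. *)
Lemma cyclic_step_contraction x y : selection x -> selection y ->
  dp_points2 p (S x) (S y) <= (1 - alpha) * dp_points2 p x y + alpha * D.
Proof.
move=> Ax Ay; have := T_contr.2 x y Ax Ay.
rewrite mulrBl mul1r; apply: le_trans.
rewrite /dp_points2 -lp_norm_ordS le_eqVlt; apply/orP; left; apply/eqP.
by congr lp_norm; apply/funext => i; rewrite !cyclic_stepE.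
Qed.

Lemma iter_step_bounded x : selection x ->
  exists M, forall n i, `|iter n S x i| <= M.
Proof.
move=> Ax; have ASx := cyclic_step_selection Ax.
pose c := lp_norm p (fun i => `|x i - S x i|).
have c0 : 0 <= c by exact: lp_norm_ge0.
have D0 : 0 <= D by exact: lp_norm_ge0.
pose a n := dp_points2 p (iter n S x) (S x).
have a0 n : 0 <= a n by exact: lp_norm_ge0.
(* The recursion is [a n.+1 <= (1 - alpha) * (a n + c) + alpha * D]. The quotient is the fixed point
   of this affine map, and [a 0] covers the start. *)
pose B := a 0 + ((1 - alpha) * c + alpha * D) / alpha.
have aB n : a n <= B.
  elim: n => [|n IHn].
    rewrite lerDl divr_ge0 ?(ltW alpha_gt0)// addr_ge0// mulr_ge0//.
      by rewrite subr_ge0 ltW.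
    exact: ltW.
  apply: le_trans (cyclic_step_contraction (iter_step_selection n Ax) Ax) _.
  have an : dp_points2 p (iter n S x) x <= B + c.
    apply: le_trans (dp_points2_triangle _ (S x) _) _; apply: lerD => //.
    by rewrite /c; apply: lp_norm_le => // i; rewrite distrC.
  have an' : (1 - alpha) * dp_points2 p (iter n S x) x <= (1 - alpha) * (B + c).
    by rewrite ler_wpM2l// subr_ge0 ltW.
  apply: le_trans (lerD an' (lexx _)) _.
  have : B * alpha = a 0 * alpha + ((1 - alpha) * c + alpha * D).
    by rewrite /B mulrDl divfK// gt_eqF.
  have : 0 <= a 0 * alpha by rewrite mulr_ge0// ltW.
  by lra.
exists (B + \sum_i `|S x (ordS i)|) => n i.
rewrite -[iter n S x i](subrK (S x (ordS i))).
apply: le_trans (ler_normD _ _) (lerD _ _).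
  apply: le_trans (aB n).
  exact: (lp_norm_coord (u := fun i => `|iter n S x i - S x (ordS i)|)).
by rewrite (bigD1 i)//= lerDl sumr_ge0.
Qed.

(** Each step multiplies the gap to [D] by at most [1 - alpha]. *)
Lemma iter_step_minimizing x e : selection x -> 0 < e ->
  \forall n \near \oo, dp_points p (iter n S x) <= D + e.
Proof.
move=> Ax e0; pose b := dp_points p x - D.
have geo n : dp_points p (iter n S x) - D <= b * (1 - alpha) ^+ n.
  elim: n => [|n IHn]; first by rewrite mulr1.
  have An := iter_step_selection n Ax.
  have := cyclic_step_contraction An An.
  have /= := ler_wpM2l (_ : 0 <= 1 - alpha) IHn.
  rewrite subr_ge0 (ltW alpha_lt1) => /(_ isT).
  rewrite exprS -/(dp_points p _) /dp_points/=; move: (dp_points2 _ _ _).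
  by move=> u; move: (dp_points2 _ _ _) (_ ^+ _) => v w; lra.
have /cvg_geometric : `|1 - alpha| < 1.
  by rewrite ger0_norm ?subr_ge0 ?(ltW alpha_lt1)// ltrBlDr ltrDl.
move=> /(_ b) /(cvgr_lt 0) /(_ e e0); apply: filterS => n.
move=> /ltW /(le_trans (geo n)).
by rewrite lerBlDl.
Qed.

Hypotheses (reflX : reflexive_space X) (A_closed : forall i, closed (A i)).
Hypothesis A_convex : forall i, convex_set (A i).

Lemma optimal_selection_exists :
  exists x, selection x /\ dp_points p x <= D.
Proof.
have [x0 Ax0] := choice A_neq0.
(* [U] refines the eventual filter, so what holds eventually holds along [U]. *)
have [U [FU ooU]] := ultraFilterLemma (eventually_filter).
pose u i n := iter n S x0 i.
have [M uM] := iter_step_bounded Ax0.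
have /choice[z uz] i : exists l, weak_limit U (u i) l.
  by apply: (weak_limit_exists reflX) => n; exact: uM.
exists z; split=> [i|].
  apply: (weak_limit_closed_convex (@A_closed i) _ _ (uz i)).
    exact: convex_setP.
  by move=> n; exact: iter_step_selection.
pose C := lp_norm p (fun _ : 'I_m => 1).
have C0 : 0 <= C by exact: lp_norm_ge0.
(* One error [d] comes from near-minimality, and the coordinatewise errors [d] have norm [d * C];
   together they make [e]. *)
apply/ler_addgt0Pr => e e0; pose d := e / (1 + C).
have d0 : 0 < d by rewrite divr_gt0//; lra.
have near_z : \forall n \near U, forall i,
    `|z i - z (ordS i)| <= `|u i n - u (ordS i) n| + d.
  by apply: filter_forall => i; exact: weak_limit_dist_le.
have near_D := ooU _ (iter_step_minimizing Ax0 d0).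
have [n [zn nD]] := filter_ex (filterI near_z near_D).
apply: (@le_trans _ _ (dp_points p (iter n S x0) + d * C)).
  rewrite -lp_normZ ?(ltW d0)//; apply: le_trans; last first.
    by apply: lp_normD => // i; rewrite mulr1 ltW.
  by apply: lp_norm_le => // i; rewrite mulr1; exact: zn.
apply: le_trans (lerD nD (lexx _)) _.
by rewrite -addrA lerD2l -{1}[d]mulr1 -mulrDr divfK// gt_eqF//; lra.
Qed.

End contraction.
End cyclic_sets.

(** * Arithmetic of cyclic indices *)

Lemma iter_ordS_val m k (i : 'I_m) : iter k (@ordS m) i = ((i + k) %% m)%N :> nat.
Proof.
elim: k => [|k IHk] /=; first by rewrite addn0 modn_small.
by rewrite IHk -addn1 modnDml addn1 addnS.
Qed.

Lemma iter_ordS_reach m (i j : 'I_m) :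
  exists2 k, (k < m)%N & iter k (@ordS m) i = j.
Proof.
have m_gt0 : (0 < m)%N by apply: leq_ltn_trans (ltn_ord i).
(* This is [j - i] modulo [m], arranged to avoid truncated subtraction. *)
exists ((j + (m - i)) %% m)%N; first by rewrite ltn_mod.
apply/val_inj; rewrite /= iter_ordS_val modnDmr addnCA subnKC ?modnDr ?modn_small//.
exact/ltnW.
Qed.

(* (+oo)^-1 = 0 in \bar R, so 2 `^ fine p^-1 is 2^(1/p), with value 1 at p = +oo. *)
Theorem theorem4p3 (R : realType) (X : completeNormedModType R)
    (reflX : reflexive_space X) (scX : strictly_convex_space X)
    (m : nat) (m_gt0 : (0 < m)%N) (A : 'I_m -> set X)
    (A_neq0 : forall i, A i !=set0)
    (A_closed : forall i, closed (A i))
    (A_convex : forall i, convex_set (A i))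
    (A_diff : forall i,
      diff_set (A i) `&` diff_set (A (ordS i)) = [set 0])
    (p : \bar R) (p_ge1 : (1 <= p)%E)
    (alpha : R) (alpha_gt0 : 0 < alpha) (alpha_lt1 : alpha < 1)
    (alpha_m : 0 < alpha ^+ m < 1 / (2 `^ fine p^-1%E))
    (T : X -> X) (T_contr : cyclic_contraction p alpha A T) :
  exists! x : X, [/\ A (Ordinal m_gt0) x,
    iter m T x = x &
    dp_points p (fun i : 'I_m => iter i T x) = dp_sets p A].
Proof.
pose o := Ordinal m_gt0; pose S := cyclic_step T : ('I_m -> X) -> 'I_m -> X.
have iter_o (i : 'I_m) : iter i (@ordS m) o = i.
  by apply/val_inj; rewrite /= iter_ordS_val add0n modn_small.
have iter_m : iter m (@ordS m) o = o.
  by apply/val_inj; rewrite /= iter_ordS_val add0n modnn.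
(* A fixed point of [S] is a cycle of [T], so any one coordinate determines the others. *)
have fixed_iter x k i : S x = x -> iter k T (x i) = x (iter k (@ordS m) i).
  move=> Sx; rewrite -(iter_cyclic_stepE T 0 k x i) addn0.
  by rewrite (iter_fix _ Sx).
have [j agree] := optimal_selections_agree A_neq0 p_ge1 m_gt0 scX A_convex A_diff.
have [z [Az zD]] := optimal_selection_exists A_neq0 p_ge1 alpha_gt0 alpha_lt1
  T_contr reflX A_closed A_convex.
(* With [d = dp_sets p A], the contraction bound [(1 - alpha) * d + alpha * d] is [d] again. *)
have optS n : selection A (iter n S z) /\ dp_points p (iter n S z) <= dp_sets p A.
  elim: n => [//|n [An nD]]; split; first exact: cyclic_step_selection T_contr _ An.
  apply: le_trans (cyclic_step_contraction T_contr An An) _.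
  have := ler_wpM2l (_ : 0 <= 1 - alpha) nD; rewrite subr_ge0 (ltW alpha_lt1).
  move=> /(_ isT); rewrite -/(dp_points p _).
  by move: (dp_points _ _) (dp_sets _ _) => u v; lra.
pose w := iter m S z; have [Aw wD] := optS m.
have Sw : S w = w.
  apply/funext => i; have [k /ltnW km <-] := iter_ordS_reach j i.
  (* This coordinate is [iter k T] of the coordinate [j] of an optimal selection, hence independent
     of [n]; it is used for [n = m] and [n = m.+1]. *)
  have shift n : (k <= n)%N -> iter n S z (iter k (@ordS m) j) = iter k T (z j).
    move=> kn; rewrite -[n in iter n](subnKC kn) iter_cyclic_stepE.
    by rewrite (agree _ z (optS _).1 (optS _).2 Az zD).
  by rewrite -[S w]/(iter m.+1 S z) /w !shift ?(leqW km) ?km.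
exists (w o); split.
  have wE : (fun i : 'I_m => iter i T (w o)) = w.
    by apply/funext => i; rewrite fixed_iter// iter_o.
  split; [exact: Aw|by rewrite fixed_iter// iter_m|rewrite wE].
  by apply/le_anti; rewrite wD; exact: dp_points2_ge.
(* For uniqueness, the orbit of a competitor [y] is read as a selection, which is again a fixed
   point of [S]. *)
move=> y [Ay Ty yD]; pose v (i : 'I_m) := iter i T y.
have Av : selection A v.
  move=> i; rewrite -[i in A i]iter_o /v; elim: (nat_of_ord i) => [//|k IHk] /=.
  by apply: T_contr.1; exists (iter k T y).
have Sv : S v = v.
  apply/funext => i; rewrite -(ord_predK i) /S cyclic_stepE.
  move: (ord_pred i) => k; rewrite /v /= -iterS.
  have [k_lt|] := ltnP k.+1 m; first by rewrite modn_small.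
  (* At the wrap-around the next index is 0, and the claim is [iter m T y = y]. *)
  move=> m_le; have -> : k.+1 = m by apply/eqP; rewrite eqn_leq m_le andbT ltn_ord.
  by rewrite modnn.
have vwj : v j = w j by apply: agree => //; rewrite yD.
(* Agreement at [j] is carried along the two cycles to the index [o]. *)
have [k _ kE] := iter_ordS_reach j o.
by rewrite -kE -fixed_iter// -vwj fixed_iter// kE.
Qed.
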